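(* Let $f:S^2\to\mathbb{R}$ be a continuous function. Assume that for every $u\in S^2$ there exists $T_u\in SO(u^{\perp})\setminus\{\pm Id\}$ such that $f(T_ux)=f(x)$ for all $x\in S^2\cap u^{\perp}$. Then $f$ is constant.
   Context: $S^2$ is the unit sphere of $\mathbb{R}^3$, $u^\perp=\{x\in\mathbb{R}^3:\langle x,u\rangle=0\}$, and $SO(u^\perp)$ is the group of rotations of the 2-dimensional Euclidean space $u^\perp$ (about the origin). *)

(* Defs.v *)
From HB Require Import structures.
From mathcomp Require Import all_boot all_order all_algebra.
From mathcomp Require Import all_classical all_reals all_analysis.

Set Implicit Arguments.
Unset Strict Implicit.
Unset Printing Implicit Defensive.

Import Order.TTheory GRing.Theory Num.Theory.
Import numFieldNormedType.Exports.

Local Open Scope classical_set_scope.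
Local Open Scope ring_scope.

Definition dot (R : realType) (n : nat) (x y : 'rV[R]_n) : R :=
  (x *m y^T) 0 0.

(* The library norm `|x| on 'rV[R]_n is the sup norm, hence this definition. *)
Definition enorm (R : realType) (n : nat) (x : 'rV[R]_n) : R :=
  Num.sqrt (dot x x).

Definition S2 (R : realType) : set 'rV[R]_3 := [set x | enorm x = 1].
Arguments S2 {R}.

Definition perp (R : realType) (n : nat) (u : 'rV[R]_n) : {vspace 'rV[R]_n} :=
  lker (linfun (mulmxr u^T)).

Lemma mem_perp (R : realType) (n : nat) (u x : 'rV[R]_n) :
  (x \in perp u) = (dot x u == 0).
Proof.
rewrite memv_ker lfunE /= /dot; apply/eqP/eqP => [-> | h].
  by rewrite mxE.
by apply/rowP => i; rewrite !ord1 h mxE.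
Qed.

(* Determinant of an endomorphism, computed in an arbitrary basis; it does not
   depend on the basis by detendE below. *)
Definition detend (K : fieldType) (V : vectType K) (T : 'End(V)) : K :=
  \det (passmx.mxof (vbasis {:V}) (vbasis {:V}) T).

Lemma detendE (K : fieldType) (V : vectType K) (e : (\dim {:V}).-tuple V)
    (T : 'End(V)) :
  basis_of {:V} e -> detend T = \det (passmx.mxof e e T).
Proof.
move=> eB; have bB := vbasisP {:V}; rewrite /detend; set b := vbasis _ in bB *.
have -> : passmx.mxof b b T = passmx.mxof b e \1%VF *m passmx.mxof e e T
                              *m passmx.mxof e b \1%VF.
  by rewrite -!passmx.mxof_comp // comp_lfun1l comp_lfun1r.
rewrite !det_mulmx mulrAC -det_mulmx -passmx.mxof_comp // comp_lfun1l.
by rewrite passmx.mxof1 ?(basis_free bB) // det1 mul1r.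
Qed.

Definition SO (R : realType) (n : nat) (W : {vspace 'rV[R]_n}) :
    set 'End(subvs_of W) :=
  [set T : 'End(subvs_of W) |
    (forall x y : subvs_of W,
       dot (vsval (T x)) (vsval (T y)) = dot (vsval x) (vsval y))
    /\ detend T = 1].
Arguments SO {R n} W.

(* Main.v *)
Require Import Defs.
From HB Require Import structures.
From mathcomp Require Import all_boot all_order all_algebra.
From mathcomp Require Import ring lra.
From mathcomp Require Import all_classical all_reals all_analysis.

Set Implicit Arguments.
Unset Strict Implicit.
Unset Printing Implicit Defensive.

Import Order.TTheory GRing.Theory Num.Theory.
Import numFieldNormedType.Exports.

Local Open Scope classical_set_scope.
Local Open Scope ring_scope.

(* A rotation of a great circle by an angle a with sin a <> 0 kills the first
   and second Fourier modes of every continuous function that it preserves, so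
   for every great circle C the modes cos t and cos 2t of f on C vanish. These
   conditions are linear in f, hence can be averaged over the rotations about a
   fixed N in S^2. The average of f over the parallel at height t is a
   continuous function P of t in [-1, 1], and the great circles reaching height
   s give
     int cos t P(s cos t) dt = 0  and  int cos 2t P(s cos t) dt = 0, 0 < s <= 1.
   Both are Abel-type equations. Write a(s) = int Q(s cos t) dt,
   c(s) = int cos^2 t Q(s cos t) dt, and D(s) = int cos t Q1(s cos t) dt with
   Q1' = Q. Then D = s (a - c) and D' = c. So a = 0 implies (s D)' = 0 and
   c = 0, that is, a also vanishes for t^2 Q(t), and inductively for all
   t^2n Q(t); since cos^2n t concentrates at 0 and pi, Q(1) + Q(-1) = 0.
   Similarly a = 2 c implies (D / s)' = 0, so that a is constant. With
   Q(t) = t P(t), resp. Q = P and then Q = P - P(0), this gives P(1) = P(-1) and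
   P(1) + P(-1) = 2 P(0): f is even, and f(N) is the mean of f over the equator
   of N. At a maximum point N of f, f is therefore constant on the equator of N,
   whose points are again maximum points; every x in S^2 is on the equator of
   such a point. *)

(** * Integration over the circle *)

Section CircleIntegral.
Context {R : realType}.
Notation mu := (@lebesgue_measure R).
Implicit Types (g : R -> R) (h : R -> R -> R).

Definition circ (g : R -> R) : R := \int[mu]_(t in `[0, pi *+ 2]) g t.

Lemma pi2_gt0 : 0 < pi *+ 2 :> R.
Proof. by rewrite pmulrn_lgt0 ?pi_gt0. Qed.

Lemma integrable_segment g (a b : R) :
  continuous g -> mu.-integrable `[a, b] (EFin \o g).
Proof.
move=> cg; apply: continuous_compact_integrable; first exact: segment_compact.
exact: continuous_subspaceT.
Qed.

Lemma is_derive_cont (G : R -> R) (g' x : R) :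
  is_derive x (1 : R) G g' -> {for x, continuous G}.
Proof.
by move=> dG; apply/differentiable_continuous/derivable1_diffP.
Qed.

Lemma is_derive_mul (f g : R -> R) (df dg x : R) :
  is_derive x (1 : R) f df -> is_derive x (1 : R) g dg ->
  is_derive x (1 : R) (fun t => f t * g t) (f x * dg + df * g x).
Proof. by move=> hf hg; have := is_deriveM hf hg; rewrite /GRing.scale/= [df * _]mulrC. Qed.

Lemma is_derive_add (f g : R -> R) (df dg x : R) :
  is_derive x (1 : R) f df -> is_derive x (1 : R) g dg ->
  is_derive x (1 : R) (fun t => f t + g t) (df + dg).
Proof. by move=> hf hg; exact: is_deriveD. Qed.

Lemma is_derive_lin (k x : R) : is_derive x (1 : R) ( *%R k) k.
Proof.
have := is_derive_mul (is_derive_cst k x 1) (is_derive_id x (1 : R)).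
by rewrite mulr1 mul0r addr0.
Qed.

Lemma FTC_circ (G g : R -> R) : continuous g ->
  (forall x, is_derive x (1 : R) G (g x)) -> circ g = G (pi *+ 2) - G 0.
Proof.
move=> cg dG; rewrite /circ /Rintegral (@continuous_FTC2 _ g G) ?pi2_gt0//.
- exact: continuous_subspaceT.
- have cG x : {for x, continuous G} by exact: is_derive_cont.
  split; first by move=> x _; have [] := dG x.
    by apply: cvg_at_right_filter; exact: cG.
  by apply: cvg_at_left_filter; exact: cG.
- by move=> x _; rewrite derive1E; have [] := dG x.
Qed.

(* An antiderivative on the whole line: one of the two intervals is empty or a
   point. *)
Definition prim g (x : R) : R :=
  \int[mu]_(t in `[0, x]) g t - \int[mu]_(t in `[x, 0]) g t.

(** Chasles' relation from a base point [b] left of both [0] and [x]: up to a constant, [prim g]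
    becomes an integral with a fixed lower end, the form that the fundamental theorem of calculus
    differentiates. *)
Lemma primE g (b x : R) : continuous g -> b <= 0 -> b <= x ->
  prim g x = \int[mu]_(t in `[b, x]) g t - \int[mu]_(t in `[b, 0]) g t.
Proof.
move=> cg b0 bx; rewrite /prim; have [x0|x0] := leP 0 x.
  have -> : \int[mu]_(t in `[x, 0]) g t = 0.
    move: x0; rewrite le_eqVlt => /predU1P[<-|x0].
      by rewrite set_itv1 Rintegral_set1.
    by rewrite set_itv_ge ?Rintegral_set0// bnd_simp -?leNgt -?ltNge.
  rewrite subr0 Rintegral_itvB ?Rintegral_itv_obnd_cbnd//.
  - apply: (@integrableS _ _ _ mu `[0, x]) => //.
      exact: subset_itv_oc_cc.
    exact: integrable_segment.
  - exact: integrable_segment.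
rewrite [X in X - _](_ : _ = 0); last first.
  by rewrite set_itv_ge ?Rintegral_set0// bnd_simp -?leNgt -?ltNge.
rewrite sub0r -[RHS]opprB; congr (- _).
rewrite Rintegral_itvB ?Rintegral_itv_obnd_cbnd//.
- apply: (@integrableS _ _ _ mu `[x, 0]) => //.
    exact: subset_itv_oc_cc.
  exact: integrable_segment.
- exact: integrable_segment.
- by rewrite bnd_simp ltW.
Qed.

Lemma is_derive_prim g (x : R) :
  continuous g -> is_derive x (1 : R) (prim g) (g x).
Proof.
move=> cg; pose b := - (`|x| + 1).
have bx : b < x by rewrite /b ltrNl; have := ler_norm (- x); rewrite normrN; lra.
have b0 : b <= 0 by rewrite /b; have := normr_ge0 x; lra.
pose F y := \int[mu]_(t in `[b, y]) g t.
have [dF F'] : derivable F x 1 /\ derive1 F x = g x.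
  apply: (@continuous_FTC1_closed _ g b x (x + 1)) => //.
  - by rewrite ltrDl.
  - exact: integrable_segment.
  - exact: cg.
have dG : is_derive x (1 : R) (fun y => F y - F 0) (g x).
  have dF' : is_derive x (1 : R) F (g x).
    by apply: DeriveDef; [exact: dF|rewrite -derive1E; exact: F'].
  apply: is_derive_eq; by rewrite subr0.
have e : \forall y \near x, F y - F 0 = prim g y.
  near=> y; rewrite (@primE g b)//.
  by near: y; apply: (cvgr_ge x) => //; exact: cvg_id.
exact: near_eq_is_derive e dG.
Unshelve. all: by end_near. Qed.

End CircleIntegral.

Section CircleIntegralTheory.
Context {R : realType}.
Notation mu := (@lebesgue_measure R).
Implicit Types (g : R -> R) (h : R -> R -> R).

Lemma eq_circ g1 g2 : g1 =1 g2 -> circ g1 = circ g2.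
Proof. by move=> /funext ->. Qed.

Lemma circD g1 g2 : continuous g1 -> continuous g2 ->
  circ (fun t => g1 t + g2 t) = circ g1 + circ g2.
Proof. by move=> c1 c2; rewrite /circ RintegralD//; exact: integrable_segment. Qed.

Lemma circB g1 g2 : continuous g1 -> continuous g2 ->
  circ (fun t => g1 t - g2 t) = circ g1 - circ g2.
Proof. by move=> c1 c2; rewrite /circ RintegralB//; exact: integrable_segment. Qed.

Lemma circZ (k : R) g : continuous g -> circ (fun t => k * g t) = k * circ g.
Proof. by move=> c; rewrite /circ RintegralZl//; exact: integrable_segment. Qed.

Lemma circ_cst (k : R) : circ (fun=> k) = k * (pi *+ 2).
Proof.
have cc : continuous (fun _ : R => k) by move=> x; exact: cvg_cst.
by rewrite (FTC_circ cc (is_derive_lin k)) mulr0 subr0.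
Qed.

Lemma le_circ g1 g2 : continuous g1 -> continuous g2 ->
  (forall t, g1 t <= g2 t) -> circ g1 <= circ g2.
Proof. by move=> c1 c2 g12; apply: le_Rintegral => //; exact: integrable_segment. Qed.

(** The primitive of [g] from 0 is squeezed between 0 and the total integral 0, so it vanishes on
    the open interval, and so does its derivative [g]. *)
Lemma circ_eq0 g (t : R) : continuous g -> (forall t, 0 <= g t) -> circ g = 0 ->
  0 < t < pi *+ 2 -> g t = 0.
Proof.
move=> cg g0 circ0 t01.
have G0 x : x \in `]0, pi *+ 2[ -> prim g x = 0.
  rewrite in_itv/= => /andP[x0 x1].
  rewrite (@primE _ _ 0)// ?ltW// set_itv1 Rintegral_set1 subr0.
  apply/eqP; rewrite eq_le; apply/andP; split; last exact: Rintegral_ge0.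
  rewrite -[leRHS]circ0 -subr_ge0 /circ Rintegral_itvB ?bnd_simp ?(ltW x0) ?(ltW x1)//.
    exact: Rintegral_ge0.
  exact: integrable_segment.
have e : \forall y \near t, prim g y = cst 0 y.
  have : t \in `]0, pi *+ 2[ by rewrite in_itv.
  by move=> /near_in_itvoo; apply: filterS => y /G0.
have := near_eq_is_derive e (is_derive_prim t cg).
by move=> [_ <-]; rewrite derive_cst.
Qed.

(** Domination by constants, uniform in [t] but only local in [x]: the integrands [P (x * cos t)]
    below need not be bounded over all [x]. *)
Definition strip_bounded h :=
  forall K : R, exists M : R, forall x t, `|x| <= K -> `|h x t| <= M.

Lemma integral_continuous h (a b : R) :
  (forall x, continuous (h x)) -> (forall t, continuous (h^~ t)) ->
  strip_bounded h -> continuous (fun x => \int[mu]_(t in `[a, b]) h x t).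
Proof.
move=> c1 c2 bh x; have [M hM] := bh (`|x| + 1).
apply: (@continuity_under_integral R _ _ mu h `[a, b] _ (x - 1) (x + 1)
  _ _ (fun=> M)) => //.
- by move=> y _; exact: integrable_segment.
- by apply: aeW => t _ y _; exact: c2.
- by apply: integrable_segment => t; exact: cvg_cst.
- move=> y /=; rewrite in_itv/= => /andP[y1 y2]; apply: aeW => t _; apply: hM.
  rewrite ler_norml; have := ler_norm x; have := ler_norm (- x); rewrite normrN.
  lra.
- by rewrite inE/= in_itv/=; lra.
Qed.

Lemma circ_continuous h :
  (forall x, continuous (h x)) -> (forall t, continuous (h^~ t)) ->
  strip_bounded h -> continuous (fun x => circ (h x)).
Proof. exact: integral_continuous. Qed.

Lemma is_derive_circ h h' (x : R) :
  (forall x, continuous (h x)) ->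
  (forall x t, is_derive x (1 : R) (h^~ t) (h' x t)) ->
  strip_bounded h' -> is_derive x (1 : R) (fun x => circ (h x)) (circ (h' x)).
Proof.
move=> c1 dh bh; have [M hM] := bh (`|x| + 1).
have hE y t : partial1of2 h y t = h' y t by rewrite partial1of2E; have [] := dh y t.
have Ix : [set` `]x - 1, x + 1[] x by rewrite /= in_itv/=; lra.
have i1 (y : R) : [set` `]x - 1, x + 1[] y -> mu.-integrable `[0, pi *+ 2] (EFin \o h y).
  by move=> _; exact: integrable_segment.
have d1 (y t : R) : [set` `]x - 1, x + 1[] y -> [set` `[0, pi *+ 2]] t ->
    derivable (h^~ t) y 1 by move=> _ _; have [] := dh y t.
(* The absolute value of [M] is taken because the dominating function has to be nonnegative. *)
have i2 : mu.-integrable `[0, pi *+ 2] (EFin \o (fun=> `|M|)).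
  by apply: integrable_segment => t; exact: cvg_cst.
have b (y t : R) : [set` `]x - 1, x + 1[] y -> [set` `[0, pi *+ 2]] t ->
    `|partial1of2 h y t| <= `|M|.
  rewrite /= in_itv/= => /andP[y1 y2] _; rewrite hE.
  apply: le_trans (ler_norm _); apply: hM.
  rewrite ler_norml; have := ler_norm x; have := ler_norm (- x); rewrite normrN.
  lra.
have M0 (t : R) : 0 <= `|M| by [].
have D := @derivable_under_integral R _ _ mu h `[0, pi *+ 2] _ x _ _ Ix i1 d1 _ M0 i2 b.
have D' := @differentiation_under_integral R _ _ mu h `[0, pi *+ 2] _ x _ _ Ix i1 d1 _ M0 i2 b.
apply: DeriveDef; first exact: D.
by rewrite -derive1E D'//; apply: eq_circ => t; exact: hE.
Qed.

End CircleIntegralTheory.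

Section AbelEquation.
Context {R : realType}.
Notation mu := (@lebesgue_measure R).
Implicit Types (f g P : R -> R) (h : R -> R -> R).

Lemma continuous_add (T : topologicalType) (f g : T -> R) :
  continuous f -> continuous g -> continuous (fun t => f t + g t).
Proof. by move=> cf cg t; apply: cvgD; [exact: cf|exact: cg]. Qed.

Lemma continuous_opp f : continuous f -> continuous (fun t => - f t).
Proof. by move=> cf t; apply: cvgN; exact: cf. Qed.

Lemma continuous_mul (T : topologicalType) (f g : T -> R) :
  continuous f -> continuous g -> continuous (fun t => f t * g t).
Proof. by move=> cf cg t; apply: cvgM; [exact: cf|exact: cg]. Qed.

Lemma continuous_exp f n : continuous f -> continuous (fun t => f t ^+ n).
Proof.
move=> cf; elim: n => [|n IH]; first by move=> t; exact: cvg_cst.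
under eq_fun do rewrite exprS; exact: continuous_mul.
Qed.

Lemma continuous_after f g :
  continuous g -> continuous f -> continuous (fun t => g (f t)).
Proof. by move=> cg cf t; apply: continuous_comp; [exact: cf|exact: cg]. Qed.

Lemma continuous_const (k : R) : continuous (fun _ : R => k).
Proof. by move=> t; exact: cvg_cst. Qed.

Lemma continuous_scale (k : R) : continuous ( *%R k).
Proof. by move=> t; apply: cvgM; [exact: cvg_cst|exact: cvg_id]. Qed.

Lemma continuous_idfun : continuous (fun t : R => t).
Proof. by move=> t; exact: cvg_id. Qed.

Lemma continuous_scale_cos (s : R) : continuous (fun t => s * cos t).
Proof. apply: continuous_after; [exact: continuous_scale|exact: continuous_cos]. Qed.

Lemma prim0 g : prim g 0 = 0.
Proof. by rewrite /prim set_itv1 Rintegral_set1 subrr. Qed.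

Lemma prim_circ g : prim g (pi *+ 2) = circ g.
Proof.
rewrite /prim [X in _ - X](_ : _ = 0) ?subr0//.
by rewrite set_itv_ge ?Rintegral_set0// bnd_simp -ltNge; exact: pi2_gt0.
Qed.

Lemma is_derive_compose (f g : R -> R) (df dg x : R) :
  is_derive (g x) (1 : R) f df -> is_derive x (1 : R) g dg ->
  is_derive x (1 : R) (fun t => f (g t)) (df * dg).
Proof. exact: is_derive1_comp. Qed.

(** By periodicity [prim g (t + pi *+ 2) - prim g t] has derivative 0 in [t], so its values at [0]
    and at [a] agree. *)
Lemma circ_shift g (a : R) : continuous g -> periodic g (pi *+ 2) ->
  circ (fun t => g (t + a)) = circ g.
Proof.
move=> cg pg.
have cs : continuous (fun t => t + a).
  by apply: continuous_add; [exact: continuous_idfun|exact: continuous_const].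
have ds (b x : R) : is_derive x (1 : R) (fun t => t + b) 1.
  have := is_derive_add (is_derive_id x (1 : R)) (is_derive_cst b x (1 : R)).
  by rewrite addr0.
have dG (b x : R) : is_derive x (1 : R) (fun t => prim g (t + b)) (g (x + b)).
  have := @is_derive_compose (prim g) (fun t => t + b) _ _ x (is_derive_prim _ cg) (ds b x).
  by rewrite mulr1.
rewrite (FTC_circ (continuous_after cg cs) (dG a)).
have /(is_derive_0_is_cst 0 a) : forall x : R,
    is_derive x (1 : R) (fun t => prim g (t + pi *+ 2) + - prim g t) 0.
  move=> x; have := is_derive_add (dG (pi *+ 2) x) (is_deriveN (is_derive_prim x cg)).
  by rewrite pg subrr.
by rewrite !add0r prim0 oppr0 addr0 prim_circ [_ *+ 2 + a]addrC => ->.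
Qed.

(** Differentiation under the integral shows that the integral over [t] of [prim (h^~ t) x] has
    derivative [circ (h x)] in [x]. Its increment from 0 to 2 pi is then both iterated integrals. *)
Lemma circ_Fubini h (M : R) :
  (forall x, continuous (h x)) -> (forall t, continuous (h^~ t)) ->
  (forall x t, `|h x t| <= M) ->
  circ (fun x => circ (h x)) = circ (fun t => circ (h^~ t)).
Proof.
move=> c1 c2 hM.
have b1 : strip_bounded h by move=> K; exists M.
have b2 : strip_bounded (fun t x => h x t) by move=> K; exists M => x t _; exact: hM.
have cE (x : R) : continuous (fun t => prim (h^~ t) x).
  apply: continuous_add; last apply: continuous_opp.
    exact: (integral_continuous (h := fun t x => h x t)).
  exact: (integral_continuous (h := fun t x => h x t)).
have dE (x : R) : is_derive x (1 : R) (fun x => circ (fun t => prim (h^~ t) x)) (circ (h x)).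
  by apply: is_derive_circ => // y t; apply: is_derive_prim.
rewrite (FTC_circ _ dE); last exact: circ_continuous.
rewrite [X in _ - X](_ : _ = 0); last first.
  by under eq_circ do rewrite prim0; rewrite circ_cst mul0r.
by rewrite subr0; apply: eq_circ => t; rewrite prim_circ.
Qed.

Lemma continuous_bounded P (K : R) : continuous P ->
  exists M : R, forall x, `|x| <= K -> `|P x| <= M.
Proof.
move=> cP.
have cnP : continuous (fun x => `|P x|).
  by move=> x; apply: cvg_norm; exact: cP.
(* The absolute value of [K] keeps the segment nonempty for negative [K]. *)
have [K0|K0] := leP (- `|K|) `|K|; last by have := normr_ge0 K; lra.
have [c _ hc] := EVT_max K0 (continuous_subspaceT cnP).
exists `|P c| => x xK; apply: hc; rewrite in_itv/=.
by rewrite -ler_norml (le_trans xK)// ler_norm.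
Qed.

(** * The Abel-type equations *)

Section Step.
Variable P : R -> R.
Hypothesis cP : continuous P.
(** The function D of the overview, whose Q is [P] here, with [prim P] for Q1. *)
Let D (s : R) := circ (fun t => cos t * prim P (s * cos t)).

Let c_continuous : forall s : R, continuous (fun t => cos t * (P (s * cos t) * cos t)).
Proof.
move=> s; apply: continuous_mul; first exact: continuous_cos.
apply: continuous_mul; last exact: continuous_cos.
exact: continuous_after cP (@continuous_scale_cos s).
Qed.

Let c_bounded : strip_bounded (fun s t : R => cos t * (P (s * cos t) * cos t)).
Proof.
move=> K; have [M hM] := continuous_bounded K cP.
exists M => x t xK; have h1 := cos_max t.
have xc : `|x * cos t| <= K by rewrite normrM (le_trans _ xK)// ler_piMr.
rewrite !normrM mulrCA; apply: le_trans (hM _ xc).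
by rewrite ler_piMr// mulr_ile1.
Qed.

Lemma is_derive_cos_prim (s : R) :
  is_derive s (1 : R) D (circ (fun t => cos t * (P (s * cos t) * cos t))).
Proof.
apply: (is_derive_circ (h' := fun s t => cos t * (P (s * cos t) * cos t))).
- move=> x; apply: continuous_mul; first exact: continuous_cos.
  apply: continuous_after (@continuous_scale_cos x) => y.
  exact: is_derive_cont (is_derive_prim y cP).
- move=> x t.
  have d1 : is_derive x (1 : R) (fun x => x * cos t) (cos t).
    by under eq_fun do rewrite mulrC; exact: is_derive_lin.
  have := is_derive_mul (is_derive_cst (cos t) x (1 : R))
    (@is_derive_compose (prim P) (fun x => x * cos t) _ _ x (is_derive_prim _ cP) d1).
  by rewrite mul0r addr0.
- exact: c_bounded.
Qed.

(** The derivative of [sin t * prim P (s * cos t)] integrates to 0, as [sin] vanishes at both ends;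
    replacing sin^2 by 1 - cos^2 in it gives the two integrals on the right. *)
Lemma cos_prim_by_parts (s : R) :
  D s = s * (circ (fun t => P (s * cos t))
             - circ (fun t => cos t * (P (s * cos t) * cos t))).
Proof.
have cQ : continuous (fun t => P (s * cos t)).
  exact: continuous_after cP (@continuous_scale_cos s).
have cprim : continuous (fun t => prim P (s * cos t)).
  apply: continuous_after (@continuous_scale_cos s) => y.
  exact: is_derive_cont (is_derive_prim y cP).
rewrite -circB// -circZ; last first.
  by apply: continuous_add => //; exact: continuous_opp.
have d (x : R) : is_derive x (1 : R) (fun t => sin t * prim P (s * cos t))
    (cos x * prim P (s * cos x) +
      - (s * (P (s * cos x) - cos x * (P (s * cos x) * cos x)))).
  have d1 : is_derive x (1 : R) (fun x => s * cos x) (s * - sin x).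
    exact: is_derive_compose (is_derive_lin s _) (is_derive_cos x).
  have := is_derive_mul (is_derive_sin x)
    (@is_derive_compose (prim P) (fun x => s * cos x) _ _ x (is_derive_prim _ cP) d1).
  move/is_derive_eq; apply; rewrite addrC; congr (_ + _).
  have -> : P (s * cos x) - cos x * (P (s * cos x) * cos x) =
      P (s * cos x) * (1 - cos x ^+ 2) by ring.
  by rewrite -sin2cos2; ring.
have cR : continuous (fun x => s * (P (s * cos x) - cos x * (P (s * cos x) * cos x))).
  apply: continuous_after; first exact: continuous_scale.
  by apply: continuous_add => //; exact: continuous_opp.
have cL : continuous (fun x => cos x * prim P (s * cos x)).
  by apply: continuous_mul => //; exact: continuous_cos.
apply/eqP; rewrite -subr_eq0 -circB//; apply/eqP.
rewrite (FTC_circ _ d).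
  by rewrite sin2pi sin0 !mul0r subrr.
by apply: continuous_add => //; exact: continuous_opp.
Qed.

Let cD : continuous D.
Proof. by move=> s; exact: is_derive_cont (is_derive_cos_prim s). Qed.

(** Under the hypothesis D(s) = - s c(s), hence (s D)' = s c + D = 0. As s D(s) is 0 at s = 0, it
    vanishes on ]0, 1], and c with it. *)
Lemma circ_cos2_eq0 :
  (forall s : R, 0 < s <= 1 -> circ (fun t => P (s * cos t)) = 0) ->
  forall s : R, 0 < s <= 1 -> circ (fun t => cos t * (P (s * cos t) * cos t)) = 0.
Proof.
move=> a0 s s01; set c := fun s : R => circ (fun t => cos t * (P (s * cos t) * cos t)).
have DE (x : R) : 0 < x <= 1 -> D x = - (x * c x).
  by move=> x01; rewrite cos_prim_by_parts a0// sub0r mulrN.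
have /andP[s0 s1] := s01.
have dE (x : R) : x \in `]0, s[ ->
    is_derive x (1 : R) (fun x : R => x * D x) (x * c x + 1 * D x).
  by move=> _; exact: is_derive_mul (is_derive_id x _) (is_derive_cos_prim x).
have cE : continuous (fun x : R => x * D x).
  exact: continuous_mul (@continuous_idfun) cD.
have [x] := MVT s0 dE (continuous_subspaceT cE).
rewrite in_itv/= => /andP[x0 xs]; rewrite (DE x) ?x0 ?(le_trans (ltW xs))//.
rewrite mul1r [x * _ - _]subrr mul0r [0 * _]mul0r subr0 (DE s)// => /eqP.
by rewrite mulrN oppr_eq0 !mulf_eq0 (gt_eqF s0) => /eqP.
Qed.

(** Here D(s) = s c(s), hence (D / s)' = 0 and c is constant on ]0, 1]. Its limit at 0 is the
    integral of [P 0 * cos t ^+ 2], and twice this is 2 pi [P 0]. *)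
Lemma circ_mode2 :
  (forall s : R, 0 < s <= 1 -> circ (fun t => P (s * cos t)) =
     2 * circ (fun t => cos t * (P (s * cos t) * cos t))) ->
  forall s : R, 0 < s <= 1 ->
    circ (fun t => P (s * cos t)) = circ (fun t => P (0 * cos t)).
Proof.
move=> a2 s s01; set c := fun s : R => circ (fun t => cos t * (P (s * cos t) * cos t)).
have DE (x : R) : 0 < x <= 1 -> D x = x * c x.
  by move=> x01; rewrite cos_prim_by_parts a2// -/(c x); ring.
have /andP[s0 s1] := s01.
(* The mean value theorem is applied on [[r, s]] with [0 < r], since D / s is a genuine quotient
   only away from 0; the value at 0 is reached afterwards by a right limit. *)
have cst_c (r : R) : 0 < r < s -> c r = c s.
  move=> /andP[r0 rs].
  have dV (x : R) : 0 < x -> is_derive x (1 : R) (fun x : R => x^-1) (- x ^- 2).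
    move=> x0; have x0' : x != 0 by rewrite gt_eqF.
    apply: DeriveDef; first exact: (derivableV (f := id) x0').
    by rewrite (deriveV (f := id) x0')// derive_id /GRing.scale/= mulr1.
  have dE (x : R) : x \in `]r, s[ ->
      is_derive x (1 : R) (fun x : R => D x * x^-1)
      (D x * (- x ^- 2) + c x * x^-1).
    rewrite in_itv/= => /andP[rx _]; apply: is_derive_mul (is_derive_cos_prim x) (dV _ _).
    exact: lt_trans rx.
  have cE : {within `[r, s], continuous (fun x : R => D x * x^-1)}.
    apply: continuous_in_subspaceT => x; rewrite inE/= in_itv/= => /andP[rx _].
    apply: cvgM; first exact: cD.
    by apply: cvgV; [rewrite gt_eqF// (lt_le_trans r0)|exact: cvg_id].
  have [x] := MVT rs dE cE.
  rewrite in_itv/= => /andP[rx xs].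
  have x0 : 0 < x by exact: lt_trans rx.
  rewrite !DE ?x0 ?r0 ?(ltW (lt_le_trans xs s1)) ?(ltW (lt_le_trans rs s1))//.
  have -> : x * c x * - x ^- 2 + c x * x^-1 = 0 by field; rewrite gt_eqF.
  rewrite mul0r => /subr0_eq.
  by rewrite ![_ * c _]mulrC !mulfK ?gt_eqF.
have c0 : c 0 = c s.
  have cc : continuous c.
    apply: (circ_continuous (h := fun s t => cos t * (P (s * cos t) * cos t))) => //.
    move=> t; apply: continuous_mul; first exact: continuous_const.
    apply: continuous_mul; last exact: continuous_const.
    apply: continuous_after => // x; apply: cvgM; [exact: cvg_id|exact: cvg_cst].
  have h1 : c x @[x --> 0^'+] --> c 0 by apply: cvg_at_right_filter; exact: cc.
  have h2 : c x @[x --> 0^'+] --> c s.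
    apply: cvg_near_cst; near=> x; apply: cst_c; apply/andP; split.
      by near: x; exact: nbhs_right_gt.
    by near: x; exact: nbhs_right_lt.
  exact: (cvg_unique _ h1 h2).
rewrite a2// -/(c s) -c0 /c.
under eq_circ do rewrite mul0r mulrCA -expr2.
under [in RHS]eq_circ do rewrite mul0r.
have cc2 : continuous (fun t : R => cos t ^+ 2).
  exact/continuous_exp/continuous_cos.
have cs2 : continuous (fun t : R => sin t ^+ 2).
  exact/continuous_exp/continuous_sin.
rewrite circZ// circ_cst mulrCA; congr (_ * _).
(* A quarter turn exchanges the two squares, so each of them has half of the integral of the
   constant 1. *)
have hs : circ (fun t : R => sin t ^+ 2) = circ (fun t : R => cos t ^+ 2).
  rewrite -(circ_shift (pi / 2) cs2).
    by apply: eq_circ => t; rewrite sinDpihalf.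
  by move=> t; rewrite sinD2pi.
rewrite mulr_natl mulr2n -[X in _ + X]hs -circD//.
under eq_circ do rewrite cos2Dsin2.
by rewrite circ_cst mul1r.
Unshelve. all: by end_near. Qed.

End Step.
End AbelEquation.

(** * Vanishing modes of a function of the height *)

Section Zonal.
Context {R : realType}.
Implicit Types (f g P : R -> R).

Let cpow n : continuous (fun t : R => cos t ^+ n).
Proof. exact/continuous_exp/continuous_cos. Qed.

(** Obtained by integrating the derivative of [sin t * cos t ^+ n.+1]. In this form it says that the
    weight cos^n puts little mass where 1 - cos^2 is large. *)
Lemma wallis n : n.+1%:R * (circ (fun t : R => cos t ^+ n) -
  circ (fun t : R => cos t ^+ n.+2)) = circ (fun t : R => cos t ^+ n.+2).
Proof.
have d (x : R) : is_derive x (1 : R) (fun t => sin t * cos t ^+ n.+1)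
    (cos x ^+ n.+2 + - (n.+1%:R * (cos x ^+ n + - cos x ^+ n.+2))).
  have := is_derive_mul (is_derive_sin x) (is_deriveX n.+1 (is_derive_cos x)).
  under eq_fun do rewrite exprfctE.
  move/is_derive_eq; apply; rewrite /GRing.scale/=.
  have -> : cos x ^+ n + - cos x ^+ n.+2 = cos x ^+ n * (1 - cos x ^+ 2).
    by rewrite !exprS; ring.
  rewrite -sin2cos2 exprfctE !exprS; ring.
have c1 : continuous (fun t : R => cos t ^+ n + - cos t ^+ n.+2).
  by apply: continuous_add => //; exact: continuous_opp.
have c2 : continuous (fun t : R => n.+1%:R * (cos t ^+ n + - cos t ^+ n.+2)).
  exact: continuous_after (@continuous_scale _ _) c1.
have := @FTC_circ R _ _ (continuous_add (@cpow _) (continuous_opp c2)) d.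
rewrite sin2pi sin0 !mul0r subrr circB// circZ// circB//.
by move/subr0_eq.
Qed.

(** The integrand is nonnegative and equals 1 at the interior point [pi], which [circ_eq0] would
    forbid for a zero integral. *)
Lemma circ_cos_even_gt0 n : 0 < circ (fun t : R => cos t ^+ n.*2).
Proof.
have cos_ge0 t : 0 <= cos t ^+ n.*2 :> R by rewrite -muln2 mulnC exprM exprn_ge0 ?sqr_ge0.
rewrite lt_def; apply/andP; split; last first.
  by rewrite -(mul0r (pi *+ 2)) -circ_cst; apply: le_circ => //; exact: continuous_const.
apply/eqP => /(circ_eq0 (@cpow _) cos_ge0)-/(_ pi).
rewrite pi_gt0 mulr2n ltrDl pi_gt0 cospi => /(_ isT)/eqP.
by rewrite expf_eq0 oppr_eq0 oner_eq0 andbF.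
Qed.

(* The weights cos^2n concentrate at t = 0 and t = pi. *)
Lemma even_moments_le0 H : continuous H -> (forall t : R, H (- t) = H t) ->
  (forall n, circ (fun t => cos t ^+ n.*2 * H (cos t)) = 0) -> H 1 <= 0.
Proof.
move=> cH eH mH; rewrite leNgt; apply/negP => H1.
pose e := H 1 / 2; have e0 : 0 < e by rewrite divr_gt0.
have [M hM] := continuous_bounded 1 cH.
have M0 : 0 <= M by apply: le_trans (hM 0 _); rewrite // normr0.
have [d /= d0 hd] : \forall x \near (1 : R), e <= H x.
  apply: (cvgr_ge (H 1) (cH 1)).
  by rewrite /e ltr_pdivrMr// ltr_pMr// ltr1n.
(* Chosen so that [e - K * (1 - t ^+ 2)] is a lower bound of [H] on [0, 1]: it is at most [e] near
   1, and where 1 - t >= d also 1 - t^2 >= d, which makes it at most [- M]. Evenness of [H] extends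
   the bound to [-1, 0]. *)
pose K := (M + e) / d.
have K0 : 0 <= K by rewrite divr_ge0 ?addr_ge0 // ltW.
have HK0 (t : R) : 0 <= t <= 1 -> e - K * (1 - t ^+ 2) <= H t.
  move=> /andP[t0 t1]; have [td|td] := ltP (1 - t) d.
    apply: (@le_trans _ _ e).
      by rewrite lerBlDr lerDl mulr_ge0// subr_ge0 expr_le1.
    by apply: hd => /=; rewrite ger0_norm ?subr_ge0.
  apply: (@le_trans _ _ (- M)); last first.
    by move: (hM t); rewrite ger0_norm// => /(_ t1); rewrite ler_norml => /andP[].
  have : K * d <= K * (1 - t ^+ 2).
    apply: ler_wpM2l => //; apply: le_trans td _; rewrite lerB// expr2.
    exact: ler_piMl.
  by rewrite /K divfK ?gt_eqF//; lra.
have HK (t : R) : `|t| <= 1 -> e - K * (1 - t ^+ 2) <= H t.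
  have [t0|t0] := leP 0 t; first by rewrite ger0_norm// => t1; apply: HK0; rewrite t0.
  rewrite ltr0_norm// => t1; rewrite -eH -sqrrN; apply: HK0.
  by rewrite t1 oppr_ge0 ltW.
pose W n := circ (fun t : R => cos t ^+ n).
(* Integrating the lower bound against cos^2n gives e W(2n) <= K (W(2n) - W(2n+2)). By [wallis] the
   right side is K W(2n+2) / (2n+1), which is at most K W(2n) / (2n+1). *)
have main n : e * n.*2.+1%:R <= K.
  have W0 := circ_cos_even_gt0 n.
  have Wrec := wallis n.*2.
  have : (e - K) * W n.*2 + K * W n.*2.+2 <= 0.
    rewrite -circZ// -[K * _]circZ// -circD; last 2 first.
    - exact: continuous_after (@continuous_scale _ _) (@cpow _).
    - exact: continuous_after (@continuous_scale _ _) (@cpow _).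
    rewrite -(mH n); apply: le_circ.
    - apply: continuous_add; exact: continuous_after (@continuous_scale _ _) (@cpow _).
    - apply: continuous_mul => //; exact: continuous_after cH (@continuous_cos _).
    move=> t; have := ler_wpM2l _ (HK (cos t) (cos_max t)).
    move=> /(_ (cos t ^+ n.*2)); rewrite -[X in 0 <= X](mul1r) => h.
    have -> : (e - K) * cos t ^+ n.*2 + K * cos t ^+ n.*2.+2 =
       cos t ^+ n.*2 * (e - K * (1 - cos t ^+ 2)) by rewrite !exprS; ring.
    by apply: h; rewrite mul1r -muln2 mulnC exprM exprn_ge0 ?sqr_ge0.
  rewrite -/(W _) -/(W _) in W0 Wrec *.
  have W2 : W n.*2.+2 <= W n.*2.
    apply: le_circ => // t; rewrite !exprS mulrA -expr2.
    apply: ler_piMl; first by rewrite -muln2 mulnC exprM exprn_ge0 ?sqr_ge0.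
    by rewrite -[X in X <= _]addr0 -(cos2Dsin2 t) lerD2l sqr_ge0.
  move=> h.
  have h1 : e * W n.*2 <= K * (W n.*2 - W n.*2.+2) by lra.
  rewrite -(ler_pM2r W0) mulrAC.
  apply: (@le_trans _ _ (K * (W n.*2 - W n.*2.+2) * n.*2.+1%:R)).
    by rewrite ler_wpM2r.
  by rewrite -mulrA ler_wpM2l// mulrC Wrec.
have := main (Num.Def.archi_bound (K / e)).
have hb : K / e < (Num.Def.archi_bound (K / e))%:R by apply: archi_boundP; rewrite divr_ge0// ltW.
apply/negP; rewrite -ltNge mulrC -ltr_pdivrMr//.
by apply: lt_le_trans hb _; rewrite ler_nat -addnn ltnW// ltnS leq_addr.
Qed.

(** A shift by [pi] changes the sign of [cos] but not of its even powers, so [P (- t)] has the same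
    vanishing moments as [P t]. The previous lemma then applies to [P t + P (- t)] and to its
    opposite. *)
Lemma even_moments_eq0 P : continuous P ->
  (forall n, circ (fun t : R => cos t ^+ n.*2 * P (cos t)) = 0) -> P 1 + P (- 1) = 0.
Proof.
move=> cP mP.
have cQ : continuous (fun t : R => P (- t)).
  by apply: continuous_after => //; apply: continuous_opp; exact: continuous_idfun.
have cF n Q : continuous Q -> continuous (fun t : R => cos t ^+ n * Q (cos t)).
  move=> cQ'; apply: continuous_mul => //; exact: continuous_after cQ' (@continuous_cos _).
have mQ n : circ (fun t : R => cos t ^+ n.*2 * P (- cos t)) = 0.
  rewrite -[RHS](mP n) -(circ_shift pi (cF n.*2 _ cP)); last first.
    by move=> t; rewrite cosD2pi.
  apply: eq_circ => t; rewrite cosDpi.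
  by congr (_ * _); rewrite -muln2 mulnC !exprM sqrrN.
pose H t := P t + P (- t).
have cH : continuous H by exact: continuous_add.
have mH n : circ (fun t : R => cos t ^+ n.*2 * H (cos t)) = 0.
  under eq_circ do rewrite mulrDr.
  by rewrite circD ?mP ?mQ ?addr0//; [exact: cF|exact: (cF _ (fun t => P (- t)))].
apply/eqP; rewrite eq_le; apply/andP; split.
  by apply: (@even_moments_le0 H) => // t; rewrite /H opprK addrC.
rewrite -oppr_le0; apply: (@even_moments_le0 (fun t => - H t)).
- exact: continuous_opp.
- by move=> t; rewrite /H opprK addrC.
- move=> n; under eq_circ do rewrite mulrN -mulN1r.
  by rewrite circZ ?mH ?mulr0//; exact: cF.
Qed.

Lemma circ_eq0_antipodal P : continuous P ->
  (forall s : R, 0 < s <= 1 -> circ (fun t => P (s * cos t)) = 0) ->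
  P 1 + P (- 1) = 0.
Proof.
move=> cP aP; apply: even_moments_eq0 => // n.
have cPn k : continuous (fun t : R => t ^+ k * P t).
  by apply: continuous_mul => //; apply: continuous_exp; exact: continuous_idfun.
(* The induction on n carries all s in ]0, 1], as [circ_cos2_eq0] requires, although only s = 1 is
   used in the end. *)
suff: forall s : R, 0 < s <= 1 ->
    circ (fun t => (s * cos t) ^+ n.*2 * P (s * cos t)) = 0.
  by move=> /(_ 1); rewrite ltr01 lexx => /(_ isT); under eq_circ do rewrite mul1r.
elim: n => [|n IH] s s01; first by under eq_circ do rewrite mul1r; exact: aP.
(* Multiplication by s^2 turns the weight cos^2 t into (s cos t)^2, the square of the argument of
   [P]. *)
have := circ_cos2_eq0 (@cPn n.*2) IH s01; move/(congr1 ( *%R (s ^+ 2))).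
rewrite mulr0 -circZ; last first.
  apply: continuous_mul; first exact: continuous_cos.
  apply: continuous_mul; last exact: continuous_cos.
  exact: continuous_after (@cPn _) (@continuous_scale_cos _ s).
by move=> <-; apply: eq_circ => t; rewrite doubleS !exprS; ring.
Qed.

(** Multiplied by [s], the hypothesis is the equation of [circ_eq0_antipodal] for the function t
    P(t). *)
Lemma zonal_mode1 P : continuous P ->
  (forall s : R, 0 < s <= 1 -> circ (fun t => cos t * P (s * cos t)) = 0) ->
  P 1 = P (- 1).
Proof.
move=> cP aP; have cQ : continuous (fun t : R => t * P t).
  by apply: continuous_mul => //; exact: continuous_idfun.
suff /eqP : 1 * P 1 + (- 1) * P (- 1) = 0 by rewrite mul1r mulN1r subr_eq0 => /eqP.
apply: (circ_eq0_antipodal cQ) => s s01.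
rewrite -[RHS](mulr0 s) -(aP s s01) -circZ.
  by apply: eq_circ => t; rewrite mulrA.
apply: continuous_mul; first exact: continuous_cos.
exact: continuous_after cP (@continuous_scale_cos _ s).
Qed.

(** Since cos 2t = 2 cos^2 t - 1, the hypothesis is that of [circ_mode2]; by its conclusion P - P(0)
    satisfies [circ_eq0_antipodal]. *)
Lemma zonal_mode2 P : continuous P ->
  (forall s : R, 0 < s <= 1 -> circ (fun t => cos (t + t) * P (s * cos t)) = 0) ->
  P 1 + P (- 1) = 2 * P 0.
Proof.
move=> cP aP.
have cPs (s : R) : continuous (fun t : R => P (s * cos t)).
  exact: continuous_after cP (@continuous_scale_cos _ s).
have cPs2 (s : R) : continuous (fun t : R => cos t * (P (s * cos t) * cos t)).
  apply: continuous_mul; first exact: continuous_cos.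
  by apply: continuous_mul => //; exact: continuous_cos.
have a2 (s : R) : 0 < s <= 1 -> circ (fun t => P (s * cos t)) =
     2 * circ (fun t => cos t * (P (s * cos t) * cos t)).
  move=> s01; apply/esym/eqP; rewrite -subr_eq0 -circZ// -circB//; last first.
    exact: continuous_after (@continuous_scale _ _) (@cPs2 _).
  rewrite -[X in _ == X](aP s s01); apply/eqP; apply: eq_circ => t.
  by rewrite cosD -!expr2 sin2cos2; ring.
have a0 := circ_mode2 cP a2.
have cP0 : continuous (fun t : R => P t + - P 0).
  by apply: continuous_add => //; exact: continuous_const.
suff: P 1 + - P 0 + (P (- 1) + - P 0) = 0 by lra.
apply: (circ_eq0_antipodal cP0) => s s01.
rewrite circB//; last exact: continuous_const.
by rewrite a0//; under eq_circ do rewrite mul0r; rewrite subrr.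
Qed.

(** Shifting by [a] shows that the integrals of [C g] and [S g] form a vector fixed by the matrix
    with rows (p, -q) and (q, p). Subtracted from the identity, this matrix has determinant (1 -
    p)^2 + q^2, which is nonzero. *)
Lemma circ_shift_mode (C S g : R -> R) (a : R) :
  continuous C -> continuous S -> continuous g ->
  periodic C (pi *+ 2) -> periodic S (pi *+ 2) -> periodic g (pi *+ 2) ->
  (forall t, g (t + a) = g t) -> forall p q, p != 1 ->
  (forall t, C (t + a) = C t * p - S t * q) ->
  (forall t, S (t + a) = S t * p + C t * q) ->
  circ (fun t => C t * g t) = 0.
Proof.
move=> cC cS cg pC pS pg ga p q p1 CE SE.
have cCg : continuous (fun t => C t * g t) by exact: continuous_mul.
have cSg : continuous (fun t => S t * g t) by exact: continuous_mul.
have hC : circ (fun t => C t * g t) =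
    p * circ (fun t => C t * g t) - q * circ (fun t => S t * g t).
  rewrite -circZ// -circZ// -circB; last 2 first.
    exact: continuous_after (@continuous_scale _ _) cCg.
    exact: continuous_after (@continuous_scale _ _) cSg.
  rewrite -[LHS](circ_shift a cCg); last by move=> t; rewrite pC pg.
  by apply: eq_circ => t; rewrite CE ga; ring.
have hS : circ (fun t => S t * g t) =
    p * circ (fun t => S t * g t) + q * circ (fun t => C t * g t).
  rewrite -[p * _]circZ// -[q * _]circZ// -circD; last 2 first.
    exact: continuous_after (@continuous_scale _ _) cSg.
    exact: continuous_after (@continuous_scale _ _) cCg.
  rewrite -[LHS](circ_shift a cSg); last by move=> t; rewrite pS pg.
  by apply: eq_circ => t; rewrite SE ga; ring.
move: hC hS; set x := circ _; set y := circ _ => hC hS.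
have : ((1 - p) ^+ 2 + q ^+ 2) * x = 0.
  have e1 : (1 - p) * x + q * y = 0 by lra.
  have e2 : (1 - p) * y - q * x = 0 by lra.
  have -> : ((1 - p) ^+ 2 + q ^+ 2) * x =
    (1 - p) * ((1 - p) * x + q * y) - q * ((1 - p) * y - q * x) by ring.
  by rewrite e1 e2 !mulr0 subrr.
move/eqP; rewrite mulf_eq0 => /orP[|/eqP//].
rewrite paddr_eq0 ?sqr_ge0// => /andP[]; rewrite sqrf_eq0 subr_eq0 eq_sym.
by rewrite (negbTE p1).
Qed.

(** The condition [sin a != 0] is exactly cos 2a <> 1, needed for the second mode; it implies cos a
    <> 1, needed for the first. *)
Lemma rotation_modes_eq0 g (a : R) : continuous g -> periodic g (pi *+ 2) ->
  (forall t, g (t + a) = g t) -> sin a != 0 ->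
  circ (fun t => cos t * g t) = 0 /\ circ (fun t => cos (t + t) * g t) = 0.
Proof.
move=> cg pg ga sa.
have c2 : continuous (fun t : R => t + t).
  by apply: continuous_add; exact: continuous_idfun.
split.
  apply: (@circ_shift_mode cos sin g a _ _ _ _ _ _ _ (cos a) (sin a)) => //.
  - exact: continuous_cos.
  - exact: continuous_sin.
  - exact: cosD2pi.
  - exact: sinD2pi.
  - by apply: contra_neq sa => c1; apply: cos1sin0; rewrite c1 normr1.
  - by move=> t; rewrite cosD.
  - by move=> t; rewrite sinD.
have dd (t b : R) : t + b + (t + b) = (t + t) + (b + b) by ring.
apply: (@circ_shift_mode (fun t => cos (t + t)) (fun t => sin (t + t)) g a
  _ _ _ _ _ _ _ (cos (a + a)) (sin (a + a))) => //.
- exact: continuous_after (@continuous_cos _) c2.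
- exact: continuous_after (@continuous_sin _) c2.
- by move=> t; rewrite dd addrA !cosD2pi.
- by move=> t; rewrite dd addrA !sinD2pi.
- rewrite cosD -!expr2 cos2sin2; apply: contra_neq sa => h.
  by apply/eqP; rewrite -sqrf_eq0; apply/eqP; lra.
- by move=> t; rewrite dd cosD.
- by move=> t; rewrite dd sinD.
Qed.

(** [acos] gives the angle in the closed upper half-plane and its opposite below it; at the origin
    any angle would do. *)
Lemma polar (x y : R) : exists d : R,
  x = Num.sqrt (x ^+ 2 + y ^+ 2) * cos d /\ y = Num.sqrt (x ^+ 2 + y ^+ 2) * sin d.
Proof.
set r := Num.sqrt _.
have n0 : 0 <= x ^+ 2 + y ^+ 2 by rewrite addr_ge0 ?sqr_ge0.
have r2 : r ^+ 2 = x ^+ 2 + y ^+ 2 by rewrite sqr_sqrtr.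
have [r0|r0] := eqVneq r 0.
  exists 0; rewrite r0 !mul0r; move: r2; rewrite r0 expr0n/= => /esym/eqP.
  by rewrite paddr_eq0 ?sqr_ge0// !sqrf_eq0 => /andP[/eqP-> /eqP->].
have rp : 0 < r by rewrite lt_def r0 sqrtr_ge0.
have xr : -1 <= x / r <= 1.
  rewrite -ler_norml -(@ler_pXn2r _ 2) ?nnegrE// expr1n real_normK ?num_real//.
  by rewrite expr_div_n r2 ler_pdivrMr ?mul1r ?lerDl ?sqr_ge0// -r2 exprn_gt0.
have yr : (y / r) ^+ 2 = 1 - (x / r) ^+ 2.
  by rewrite !expr_div_n r2; field; rewrite -r2 expf_neq0.
have [y0|y0] := leP 0 y.
  exists (acos (x / r)); rewrite acosK ?in_itv// sin_acos// -yr.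
  rewrite sqrtr_sqr ger0_norm; last by rewrite divr_ge0 // ltW.
  by split; field; rewrite r0.
exists (- acos (x / r)); rewrite cosN sinN acosK ?in_itv// sin_acos// -yr.
rewrite sqrtr_sqr ltr0_norm ?opprK; last by rewrite pmulr_llt0 ?invr_gt0.
by split; field; rewrite r0.
Qed.

End Zonal.

(** * Rotations of a plane in R^3 *)

Section Dot.
Context {R : realType} {n : nat}.
Implicit Types (x y z : 'rV[R]_n) (k : R).

Lemma dotE x y : dot x y = \sum_i x 0 i * y 0 i.
Proof. by rewrite /dot mxE; apply: eq_bigr => i _; rewrite mxE. Qed.

Lemma dotC x y : dot x y = dot y x.
Proof. by rewrite !dotE; apply: eq_bigr => i _; rewrite mulrC. Qed.

Lemma dotDl x y z : dot (x + y) z = dot x z + dot y z.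
Proof. by rewrite /dot mulmxDl mxE. Qed.

Lemma dotZl k x y : dot (k *: x) y = k * dot x y.
Proof. by rewrite /dot -scalemxAl mxE. Qed.

Lemma dotDr x y z : dot x (y + z) = dot x y + dot x z.
Proof. by rewrite dotC dotDl !(dotC x). Qed.

Lemma dotZr k x y : dot x (k *: y) = k * dot x y.
Proof. by rewrite dotC dotZl dotC. Qed.

Definition dotDZ := (dotDl, dotDr, dotZl, dotZr).

Lemma dot_gt0 x : (0 < dot x x) = (x != 0).
Proof.
have p i : true -> 0 <= x 0 i * x 0 i by rewrite -expr2 sqr_ge0.
rewrite dotE lt_def sumr_ge0 ?andbT//; congr negb; rewrite psumr_eq0//.
apply/allP/eqP => [h|-> i _]; last by rewrite /= mxE mul0r eqxx.
apply/rowP => i; rewrite mxE; have := h i (mem_index_enum _).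
by rewrite /= mulf_eq0 orbb => /eqP.
Qed.

Definition orthonormal2 x y := [/\ dot x x = 1, dot y y = 1 & dot x y = 0].

Definition circle x y (t : R) := cos t *: x + sin t *: y.

Lemma dot_orthonormal2 x y k l k' l' : orthonormal2 x y ->
  dot (k *: x + l *: y) (k' *: x + l' *: y) = k * k' + l * l'.
Proof. by move=> [xx yy xy]; rewrite !dotDZ xx yy (dotC y) xy; ring. Qed.

Lemma dot_circle x y t : orthonormal2 x y -> dot (circle x y t) (circle x y t) = 1.
Proof. by move=> xy; rewrite dot_orthonormal2// -!expr2 cos2Dsin2. Qed.

End Dot.

Lemma S2E (R : realType) (x : 'rV[R]_3) : S2 x <-> dot x x = 1.
Proof.
have x0 : 0 <= dot x x.
  by have [->|] := eqVneq x 0; [rewrite /dot mul0mx mxE|rewrite -dot_gt0 => /ltW].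
rewrite /S2/= /enorm; split => [h|->]; last exact: sqrtr1.
by rewrite -(sqr_sqrtr x0) h expr1n.
Qed.

(** A matrix with three rows and two columns has a nonzero left kernel. Unlike a cross product, this
    also covers dependent [u] and [v], which do occur below. *)
Lemma exists_unit_normal (R : realType) (u v : 'rV[R]_3) :
  exists w, [/\ dot w w = 1, dot w u = 0 & dot w v = 0].
Proof.
pose A := row_mx u^T v^T.
have : kermx A != 0.
  rewrite -mxrank_eq0 mxrank_ker subn_eq0 -ltnNge.
  exact: leq_ltn_trans (rank_leq_col A) _.
case/rowV0Pn => w /sub_kermxP wA w0.
have /andP[/eqP wu /eqP wv] : (w *m u^T == 0) && (w *m v^T == 0).
  by rewrite -row_mx_eq0 -mul_mx_row -/A wA.
have ww : 0 < dot w w by rewrite dot_gt0.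
exists ((Num.sqrt (dot w w))^-1 *: w).
have wu0 : dot w u = 0 by rewrite /dot wu mxE.
have wv0 : dot w v = 0 by rewrite /dot wv mxE.
rewrite !dotDZ wu0 wv0 !mulr0; split => //.
by rewrite mulrA -invfM -expr2 sqr_sqrtr ?ltW// mulVf ?gt_eqF.
Qed.

(** The size is 2 only up to a propositional equality, as it will be [\dim {:V}]; the indices are
    therefore identified by their values. *)
Lemma det_mx2 (K : comNzRingType) n (M : 'M[K]_n) (i0 i1 : 'I_n) :
  n = 2 -> i0 = 0%N :> nat -> i1 = 1%N :> nat ->
  \det M = M i0 i0 * M i1 i1 - M i0 i1 * M i1 i0.
Proof.
move=> n2; move: M i0 i1; rewrite n2 => M i0 i1 h0 h1.
have -> : i0 = 0 by apply: val_inj.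
have -> : i1 = lift 0 0 by apply: val_inj.
rewrite (expand_det_row _ 0) !big_ord_recl big_ord0 /cofactor !det_mx11 !mxE/=.
rewrite expr0 expr1 addr0 !mul1r mulN1r mulrN.
by do ![congr (_ + _)|congr (- _)|congr (_ * _)|congr (M _ _)|apply: val_inj].
Qed.

Lemma big_ord2 (V : zmodType) n (F : 'I_n -> V) (i0 i1 : 'I_n) :
  n = 2 -> i0 = 0%N :> nat -> i1 = 1%N :> nat -> \sum_i F i = F i0 + F i1.
Proof.
move=> n2; move: F i0 i1; rewrite n2 => F i0 i1 h0 h1.
have -> : i0 = 0 by apply: val_inj.
have -> : i1 = lift 0 0 by apply: val_inj.
by rewrite !big_ord_recl big_ord0 addr0.
Qed.

(** By [detendE] the determinant may be computed in the basis [a], [b]; the rows of the matrix are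
    the coordinates of the images. *)
Lemma detend2 (K : fieldType) (V : vectType K) (T : 'End(V)) (a b : V) :
  \dim {:V} = 2 -> free [:: a; b] -> detend T = 1 ->
  exists p q r s, [/\ T a = p *: a + q *: b, T b = r *: a + s *: b
                    & p * s - q * r = 1].
Proof.
move=> d2 fab.
have sz : size [:: a; b] == \dim {:V} by rewrite d2.
pose e := Tuple sz.
have eB : basis_of {:V} e by rewrite /e /= basisEfree fab subvf /= d2.
rewrite (detendE _ eB); set M := passmx.mxof e e T => detM.
have l0 : (0 < \dim {:V})%N by rewrite d2.
have l1 : (1 < \dim {:V})%N by rewrite d2.
pose i0 := Ordinal l0; pose i1 := Ordinal l1.
have TE (i : 'I_(\dim {:V})) : T e`_i = M i i0 *: a + M i i1 *: b.
  rewrite -(passmx.vecof_delta e i) (passmx.hom_vecof e eB) -rowE /passmx.vecof.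
  by rewrite (@big_ord2 _ _ _ i0 i1)// !mxE.
exists (M i0 i0), (M i0 i1), (M i1 i0), (M i1 i1); split.
- exact: (TE i0).
- exact: (TE i1).
- by rewrite -detM (@det_mx2 _ _ _ i0 i1).
Qed.

Lemma dim_perp (R : realType) n (u : 'rV[R]_n) : u != 0 -> \dim (perp u) = n.-1.
Proof.
move=> u0; pose phi : 'Hom('rV[R]_n, 'rV[R]_1) := linfun (mulmxr u^T).
have := limg_ker_dim phi fullv; rewrite capfv -/(perp u).
have -> : \dim (limg phi) = 1%N.
  apply/eqP; rewrite eqn_leq; apply/andP; split.
    by apply: leq_trans (dimvS (subvf _)) _; rewrite dimvf dim_matrix.
  rewrite lt0n dimv_eq0; apply/eqP => phi0.
  have : phi u \in limg phi by rewrite memv_img ?memvf.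
  rewrite phi0 memv0 lfunE/= => /eqP/matrixP/(_ 0 0); rewrite [RHS]mxE => uu.
  by move: u0; rewrite -dot_gt0 /dot uu ltxx.
by rewrite dimvf dim_matrix addn1 => h; apply: (congr1 predn (etrans h (mul1n n))).
Qed.

(** In the basis [a], [b], an isometry of determinant 1 has the matrix with rows (p, q) and (-q, p),
    where p^2 + q^2 = 1, and [al] is the polar angle of (p, q). If [sin al] were 0, then q = 0 and p
    = 1 or -1, so that [T] would be one of the two excluded maps. *)
Lemma rotation_angle (R : realType) (u a b : 'rV[R]_3) (T : 'End(subvs_of (perp u))) :
  dot u u = 1 -> orthonormal2 a b -> dot a u = 0 -> dot b u = 0 ->
  SO (perp u) T -> T <> \1%VF -> T <> - \1%VF ->
  exists al : R, sin al != 0 /\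
    forall t, exists x : subvs_of (perp u),
      vsval x = circle a b t /\ vsval (T x) = circle a b (t + al).
Proof.
move=> uu [aa bb ab] au bu [Tdot Tdet] T1 TN1.
have pa : a \in perp u by rewrite mem_perp au.
have pb : b \in perp u by rewrite mem_perp bu.
pose a' := vsproj (perp u) a; pose b' := vsproj (perp u) b.
have a'E : vsval a' = a by rewrite vsprojK.
have b'E : vsval b' = b by rewrite vsprojK.
have comb0 (p q : R) : p *: a + q *: b = 0 -> p = 0 /\ q = 0.
  move=> h; split.
    have : dot (p *: a + q *: b) a = 0 by rewrite h /dot mul0mx mxE.
    by rewrite !dotDZ aa (dotC b) ab mulr1 mulr0 addr0.
  have : dot (p *: a + q *: b) b = 0 by rewrite h /dot mul0mx mxE.
  by rewrite !dotDZ bb ab mulr1 mulr0 add0r.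
have vsvalE (p q : R) : vsval (p *: a' + q *: b') = p *: a + q *: b.
  by rewrite linearD !linearZ /= a'E b'E.
have fab : free [:: a'; b'].
  apply/(@freeP _ _ 2 [tuple a'; b']) => k; rewrite !big_ord_recl big_ord0 addr0 /=.
  move=> /(congr1 vsval); rewrite vsvalE => /comb0[k0 k1] i.
  by case: i => -[|[|//]] i; [apply: etrans k0|apply: etrans k1]; congr k; apply: val_inj.
have d2 : \dim {:subvs_of (perp u)} = 2.
  by rewrite dimvf -[LHS]/(\dim (perp u)) dim_perp// -dot_gt0 uu ltr01.
have [p [q [r [s [Ta Tb dT]]]]] := detend2 d2 fab Tdet.
have := Tdot a' a'; rewrite Ta vsvalE a'E !dotDZ aa bb ab (dotC b) ab => pq.
have := Tdot b' b'; rewrite Tb vsvalE b'E !dotDZ aa bb ab (dotC b) ab => rs.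
have := Tdot a' b'; rewrite Ta Tb !vsvalE a'E b'E !dotDZ aa bb ab (dotC b) ab => prqs.
(* Cramer's rule for [s] and [r]: determinant 1 and orthogonality of the images are two linear
   equations in them, with determinant [p * p + q * q], that is, 1. *)
have sp : s = p.
  have : p * (p * s - q * r) + q * (p * r + q * s) = p * 1 + q * 0.
    by congr (_ * _ + _ * _) => //; rewrite -prqs; ring.
  have -> : p * (p * s - q * r) + q * (p * r + q * s) = s * (p * p + q * q) by ring.
  have -> : p * p + q * q = 1 by rewrite -pq; ring.
  by rewrite !mulr1 mulr0 addr0.
have rq : r = - q.
  have : p * (p * r + q * s) - q * (p * s - q * r) = p * 0 - q * 1.
    by congr (_ * _ - _ * _) => //; rewrite -prqs; ring.
  have -> : p * (p * r + q * s) - q * (p * s - q * r) = r * (p * p + q * q) by ring.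
  have -> : p * p + q * q = 1 by rewrite -pq; ring.
  by rewrite !mulr1 mulr0 sub0r.
have [al [pE qE]] := polar p q.
have pq1 : p ^+ 2 + q ^+ 2 = 1 by rewrite -pq; ring.
rewrite pq1 sqrtr1 !mul1r in pE qE.
have Tcomb (x y : R) : T (x *: a' + y *: b') =
    (x * p - y * q) *: a' + (x * q + y * p) *: b'.
  rewrite linearD !linearZ /= Ta Tb sp rq !scalerDr !scalerA addrACA -!scalerDl.
  by [].
exists al; split.
  apply/eqP => s0.
  have all x : exists y z, x = y *: a' + z *: b'.
    have sz : size [:: a'; b'] == 2 by [].
    have eB : basis_of {:subvs_of (perp u)} (Tuple sz).
      by rewrite /= basisEfree fab subvf /= d2.
    have := coord_basis eB (memvf x); rewrite !big_ord_recl big_ord0 addr0 /= => ->.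
    by do 2 eexists.
  have q0 : q = 0 by rewrite qE.
  have /eqP : p ^+ 2 = 1 by rewrite -pq1 q0 expr0n addr0.
  rewrite sqrf_eq1 => /orP[]/eqP p1.
    apply: T1; apply/lfunP => x; have [y [z ->]] := all x.
    by rewrite Tcomb id_lfunE q0 p1 !mulr0 !mulr1 subr0 add0r.
  apply: TN1; apply/lfunP => x; have [y [z ->]] := all x.
  by rewrite Tcomb opp_lfunE id_lfunE q0 p1 !mulr0 !mulrN1 subr0 add0r opprD !scaleNr.
move=> t; exists (cos t *: a' + sin t *: b'); split; first exact: vsvalE.
by rewrite Tcomb vsvalE /circle cosD sinD -pE -qE [X in X *: b]addrC.
Qed.

(** * Functions on the sphere *)

Section Sphere.
Context {R : realType}.
Implicit Types (p q : R -> 'rV[R]_3) (g : R -> R).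

Lemma continuous_addv p q :
  continuous p -> continuous q -> continuous (fun t => p t + q t).
Proof. by move=> cp cq t; apply: cvgD; [exact: cp|exact: cq]. Qed.

Lemma continuous_scalev g p :
  continuous g -> continuous p -> continuous (fun t => g t *: p t).
Proof. by move=> cg cp t; apply: cvgZ; [exact: cg|exact: cp]. Qed.

Lemma continuous_constv (v : 'rV[R]_3) : continuous (fun _ : R => v).
Proof. by move=> t; exact: cvg_cst. Qed.

Lemma continuous_circle (a b : 'rV[R]_3) : continuous (circle a b).
Proof.
apply: continuous_addv; apply: continuous_scalev (@continuous_constv _).
  exact: continuous_cos.
exact: continuous_sin.
Qed.

Lemma circle_periodic (a b : 'rV[R]_3) t : circle a b (t + pi *+ 2) = circle a b t.
Proof. by rewrite /circle cosD2pi sinD2pi. Qed.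

(** Continuity of [f] within the sphere becomes plain continuity along a curve that never leaves
    it. *)
Lemma within_continuous_curve (f : 'rV[R]_3 -> R) p :
  {within S2, continuous f} -> continuous p -> (forall t, S2 (p t)) ->
  continuous (fun t => f (p t)).
Proof.
move=> /subspace_continuousP cf cp Sp t.
apply: (cvg_comp p f _ (cf _ (Sp t))) => A nA.
have h : nbhs t [set s | S2 (p s) -> A (p s)] := cp t _ nA.
have : nbhs t [set s | A (p s)] by apply: filterS h => s hs; exact: hs (Sp s).
by [].
Qed.

Lemma compact_S2 : compact (@S2 R).
Proof.
apply: bounded_closed_compact.
  exists 1; split=> // M M1 x /S2E x1 /=.
  rewrite [leLHS]/Num.Def.normr /= mx_normrE; apply/bigmax_leP; split.
    exact: ltW (lt_trans ltr01 M1).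
  move=> [i j] _ /=; rewrite ord1; apply: le_trans (ltW M1).
  (* Each squared coordinate is at most the sum of all squares, so the sup norm is at most 1. *)
  rewrite -(@ler_pXn2r _ 2) ?nnegrE// expr1n real_normK ?num_real//.
  rewrite -x1 dotE (bigD1 j)//= expr2 lerDl sumr_ge0// => k _.
  by rewrite -expr2 sqr_ge0.
have dotc : continuous (fun x : 'rV[R]_3 => dot x x).
  have cc i : continuous (fun x : 'rV[R]_3 => x 0 i) by exact: coord_continuous.
  have -> : (fun x : 'rV[R]_3 => dot x x) = (fun x => x 0 0 * x 0 0 +
      (x 0 (lift 0 0) * x 0 (lift 0 0) + x 0 (lift 0 (lift 0 0)) * x 0 (lift 0 (lift 0 0)))).
    by apply/funext => x; rewrite dotE !big_ord_recl big_ord0 addr0.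
  by do 2?[apply: continuous_add]; apply: continuous_mul; exact: cc.
have -> : @S2 R = (fun x => dot x x) @^-1` [set 1].
  by apply/seteqP; split => x /S2E.
by apply: preimage_closed => [x _|]; [exact: dotc|exact: (@closed_eq R 1)].
Qed.

Lemma continuous_S2_bounded (f : 'rV[R]_3 -> R) : {within S2, continuous f} ->
  exists M : R, forall x, S2 x -> `|f x| <= M.
Proof.
move=> cf; have : bounded_set (f @` S2).
  by apply: compact_bounded; apply: continuous_compact => //; exact: compact_S2.
move=> [M [_ hM]]; exists (M + 1) => x x1.
by apply: (hM (M + 1)); [rewrite ltrDl|exists x].
Qed.

(** * Consequences of the invariance hypothesis *)

Section Invariant.
Variable f : 'rV[R]_3 -> R.
Hypothesis f_cont : {within S2, continuous f}.
Hypothesis f_inv : forall u : 'rV[R]_3, S2 u ->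
  exists T : 'End(subvs_of (perp u)),
    [/\ SO (perp u) T, T <> \1%VF, T <> - \1%VF
      & forall x : subvs_of (perp u), S2 (vsval x) ->
          f (vsval (T x)) = f (vsval x)].

(** The rotation given for a unit normal of the plane of [a] and [b] shifts the parameter of their
    great circle by an angle with nonzero sine. *)
Lemma circle_modes_eq0 a b : orthonormal2 a b ->
  circ (fun t => cos t * f (circle a b t)) = 0 /\
  circ (fun t => cos (t + t) * f (circle a b t)) = 0.
Proof.
move=> ab; have [u [uu ua ub]] := exists_unit_normal a b.
have /S2E/f_inv[T [TSO T1 TN1 fT]] := uu.
rewrite dotC in ua; rewrite dotC in ub.
have [al [sal hal]] := rotation_angle uu ab ua ub TSO T1 TN1.
have S t : S2 (circle a b t) by apply/S2E/dot_circle.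
apply: (@rotation_modes_eq0 _ (fun t => f (circle a b t)) al) => //.
- by apply: within_continuous_curve => //; exact: continuous_circle.
- by move=> t; rewrite circle_periodic.
- by move=> t; have [x [xE <-]] := hal t; rewrite -xE; apply: fT; rewrite xE.
Qed.

(** * Integrals over the parallels around a pole [N] *)

Section Frame.
Variables e1 e2 N : 'rV[R]_3.
Hypotheses (e12 : orthonormal2 e1 e2) (NN : dot N N = 1).
Hypotheses (e1N : dot e1 N = 0) (e2N : dot e2 N = 0).

Let e := circle e1 e2.

Let eN t : dot (e t) N = 0.
Proof. by rewrite !dotDZ e1N e2N !mulr0 addr0. Qed.

Let ee t : dot (e t) (e t) = 1.
Proof. exact: dot_circle. Qed.

(** A quarter turn gives the unit tangent of the equator at [e t]. *)
Let e'E t : e (t + pi / 2) = - sin t *: e1 + cos t *: e2.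
Proof. by rewrite /e /circle cosDpihalf sinDpihalf. Qed.

Let eD t d : e (t + d) = cos d *: e t + sin d *: e (t + pi / 2).
Proof.
rewrite e'E /e /circle cosD sinD !scalerDr !scalerA addrACA -!scalerDl.
by congr (_ *: _ + _ *: _); ring.
Qed.

Let ee' t : dot (e t) (e (t + pi / 2)) = 0.
Proof. by rewrite e'E dot_orthonormal2//; ring. Qed.

Let Ne t : orthonormal2 N (e t).
Proof. by split; rewrite ?ee// dotC eN. Qed.

(* The truncation of t to [-1, 1], so that lat below is defined for all t. *)
Let clamp (t : R) := (`|t + 1| - `|t - 1|) / 2.

Let clamp_id t : -1 <= t <= 1 -> clamp t = t.
Proof.
move=> /andP[t0 t1]; rewrite /clamp ger0_norm; last by lra.
by rewrite ler0_norm; lra.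
Qed.

Let clamp_sqr t : clamp t ^+ 2 <= 1.
Proof.
have h1 : `|t + 1| <= `|t - 1| + 2.
  have -> : t + 1 = t - 1 + 2 by ring.
  by apply: le_trans (ler_normD _ _) _; rewrite [`|2|]ger0_norm.
have h2 : `|t - 1| <= `|t + 1| + 2.
  have -> : t - 1 = t + 1 - 2 by ring.
  by apply: le_trans (ler_normB _ _) _; rewrite [`|2|]ger0_norm.
have : `|clamp t| <= 1 by rewrite ler_norml /clamp; lra.
by move=> h; rewrite -real_normK ?num_real// expr_le1.
Qed.

Let clamp_continuous : continuous clamp.
Proof.
have ca (k : R) : continuous (fun t : R => `|t + k|).
  move=> t; apply: cvg_norm; apply: cvgD; [exact: cvg_id|exact: cvg_cst].
apply: continuous_mul; last exact: continuous_const.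
by apply: continuous_add; [|apply: continuous_opp].
Qed.

Let lat t b := clamp t *: N + Num.sqrt (1 - clamp t ^+ 2) *: e b.

Let lat_S2 t b : S2 (lat t b).
Proof.
apply/S2E; rewrite /lat dot_orthonormal2// -!expr2 sqr_sqrtr ?subr_ge0//.
by rewrite addrC subrK.
Qed.

Let lat_continuous b : continuous (lat^~ b).
Proof.
apply: continuous_addv; apply: continuous_scalev (@continuous_constv _) => //.
apply: continuous_after; first exact: sqrt_continuous.
apply: continuous_add; first exact: continuous_const.
by apply: continuous_opp; exact: continuous_exp.
Qed.

Let lat_continuous2 t : continuous (lat t).
Proof.
apply: continuous_addv; first exact: continuous_constv.
by apply: continuous_scalev; [exact: continuous_const|exact: continuous_circle].
Qed.

(** This is 2 pi times the average P of the overview. *)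
Let Phi t := circ (fun b => f (lat t b)).

Let Phi_continuous : continuous Phi.
Proof.
have [M hM] := continuous_S2_bounded f_cont.
apply: (circ_continuous (h := fun t b => f (lat t b))).
- move=> t.
  exact: (within_continuous_curve f_cont (@lat_continuous2 t) (lat_S2 t)).
- move=> b.
  exact: (within_continuous_curve f_cont (@lat_continuous b) (lat_S2^~ b)).
- by move=> K; exists M => t b _; exact: hM.
Qed.

Section Averaging.
Variable w : R -> R.
Hypotheses (cw : continuous w) (w1 : forall t, `|w t| <= 1).
Hypothesis w0 : forall a b, orthonormal2 a b ->
  circ (fun t => w t * f (circle a b t)) = 0.

(** A great circle with highest point at height [s] is turned about [N] and its vanishing mode is
    integrated over all positions. The point at parameter t stays at height s cos t and runs through
    a whole parallel, so the exchange of integrals produces [Phi]. *)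
Lemma zonal_orthogonal (s : R) : 0 < s <= 1 -> circ (fun t => w t * Phi (s * cos t)) = 0.
Proof.
move=> /andP[s0 s1]; pose c := Num.sqrt (1 - s ^+ 2).
have s2 : s ^+ 2 <= 1 by rewrite expr_le1// ltW.
have c2 : c ^+ 2 = 1 - s ^+ 2 by rewrite sqr_sqrtr// subr_ge0.
(* [a b] is the highest point of the great circle, at longitude [b]; [a' b] is its horizontal
   direction. *)
pose a b := s *: N + c *: e b.
pose a' b := e (b + pi / 2).
have aa' b : orthonormal2 (a b) (a' b).
  split; rewrite /a /a' ?ee//.
    by rewrite dot_orthonormal2// -!expr2 c2 addrC subrK.
  by rewrite dotDl (dotZl s) (dotZl c) ee' (dotC N) eN !mulr0 addr0.
have [M hM] := continuous_S2_bounded f_cont.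
pose h t b := w t * f (circle (a b) (a' b) t).
have S t b : S2 (circle (a b) (a' b) t) by apply/S2E/dot_circle.
have ca' : continuous a'.
  move=> b; apply: (cvg_comp (fun b => b + pi / 2) e); last exact: continuous_circle.
  by apply: cvgD; [exact: cvg_id|exact: cvg_cst].
have ca : continuous a.
  apply: continuous_addv; first exact: continuous_constv.
  by apply: continuous_scalev; [exact: continuous_const|exact: continuous_circle].
have PhiE t : w t * Phi (s * cos t) = circ (h t).
  (* The horizontal part of the point at parameter t is c cos t e(b) + sin t e(b + pi/2). Its
     longitude is [b + d] with [d] independent of [b], so [d] is absorbed by a shift in the integral
     over [b]. *)
  have [d [cd sd]] := polar (c * cos t) (sin t).
  have st : s * cos t = clamp (s * cos t).
    rewrite clamp_id// -ler_norml normrM (ger0_norm (ltW s0)).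
    by rewrite mulr_ile1 ?(ltW s0) ?cos_max.
  have r2 : (c * cos t) ^+ 2 + sin t ^+ 2 = 1 - clamp (s * cos t) ^+ 2.
    by rewrite -st !exprMn c2 sin2cos2; ring.
  have latE b : lat (s * cos t) (b + d) = circle (a b) (a' b) t.
    rewrite r2 in cd sd.
    rewrite /lat eD /circle /a /a'; move: (e b) (e (b + pi / 2)) => x y.
    rewrite !scalerDr !scalerA -cd -sd -st.
    by rewrite [cos t * s]mulrC [cos t * c]mulrC addrA.
  have cl : continuous (fun b => f (lat (s * cos t) b)).
    exact: (within_continuous_curve f_cont (@lat_continuous2 _) (lat_S2 _)).
  rewrite /Phi -(circZ _ cl) /h -[LHS](circ_shift d).
  - by apply: eq_circ => b; rewrite latE.
  - exact: continuous_after (@continuous_scale _ _) cl.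
  - by move=> b; rewrite /lat /e circle_periodic.
rewrite (eq_circ PhiE) (circ_Fubini (M := M)).
- have -> : (fun b => circ (h^~ b)) = fun=> 0 by apply/funext => b; exact: w0.
  by rewrite circ_cst mul0r.
- move=> t; apply: continuous_mul; first exact: continuous_const.
  have cc : continuous (fun b => circle (a b) (a' b) t).
    apply: continuous_addv; apply: continuous_scalev.
    - exact: continuous_const.
    - exact: ca.
    - exact: continuous_const.
    - exact: ca'.
  exact: (within_continuous_curve f_cont cc (S t)).
- move=> b; apply: continuous_mul; first exact: cw.
  exact: (within_continuous_curve f_cont (@continuous_circle _ _) (S^~ b)).
- move=> t b; rewrite normrM (le_trans _ (hM _ (S t b)))// ler_piMl//.
Qed.

End Averaging.

Let Phi1 : Phi 1 = f N * (pi *+ 2).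
Proof.
rewrite -circ_cst; apply: eq_circ => b.
rewrite /lat clamp_id; last by rewrite lexx; lra.
by rewrite expr1n subrr sqrtr0 scale0r addr0 scale1r.
Qed.

Let PhiN1 : Phi (- 1) = f (- N) * (pi *+ 2).
Proof.
rewrite -circ_cst; apply: eq_circ => b.
rewrite /lat clamp_id; last by rewrite lexx; lra.
by rewrite sqrrN expr1n subrr sqrtr0 scale0r addr0 scaleN1r.
Qed.

Let Phi0 : Phi 0 = circ (fun b => f (e b)).
Proof.
apply: eq_circ => b; rewrite /lat clamp_id; last by lra.
by rewrite scale0r add0r expr0n subr0 sqrtr1 scale1r.
Qed.

(** The first mode gives Phi(1) = Phi(-1), the second Phi(1) + Phi(-1) = 2 Phi(0); hence Phi(0) =
    Phi(1). *)
Lemma mean_value_equator : circ (fun t => f (circle e1 e2 t)) = f N * (pi *+ 2).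
Proof.
have := zonal_mode1 Phi_continuous (zonal_orthogonal (@continuous_cos R) (@cos_max R)
  (fun a b ab => (circle_modes_eq0 ab).1)).
have c2 : continuous (fun t : R => cos (t + t)).
  apply: continuous_after; first exact: continuous_cos.
  by apply: continuous_add; exact: continuous_idfun.
have := zonal_mode2 Phi_continuous (zonal_orthogonal c2 (fun t => cos_max _)
  (fun a b ab => (circle_modes_eq0 ab).2)).
rewrite Phi1 PhiN1 Phi0 /e; lra.
Qed.

End Frame.

Lemma max_on_equator N x : dot N N = 1 -> dot x x = 1 -> dot x N = 0 ->
  (forall y, S2 y -> f y <= f N) -> f x = f N.
Proof.
move=> NN xx xN fmax.
have [y [yy yx yN]] := exists_unit_normal x N.
(* Starting the equator at [- x] puts [x] at the parameter [pi], inside the open interval where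
   [circ_eq0] applies. *)
have e12 : orthonormal2 (- x) y.
  by split => //; rewrite -scaleN1r !dotDZ ?xx ?(dotC x) ?yx; ring.
have e1N : dot (- x) N = 0 by rewrite -scaleN1r dotZl xN mulr0.
have cf : continuous (fun t => f (circle (- x) y t)).
  apply: within_continuous_curve => //; first exact: continuous_circle.
  by move=> t; apply/S2E/dot_circle.
have cg : continuous (fun t => f N + - f (circle (- x) y t)).
  by apply: continuous_add; [exact: continuous_const|exact: continuous_opp].
have g0 t : 0 <= f N - f (circle (- x) y t).
  by rewrite subr_ge0 fmax//; apply/S2E/dot_circle.
have := circ_eq0 (t := pi) cg g0.
rewrite circB//; last exact: continuous_const.
rewrite circ_cst (mean_value_equator e12 NN e1N yN) subrr => /(_ erefl).
rewrite pi_gt0 mulr2n ltrDl pi_gt0 => /(_ isT).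
by rewrite /circle cospi sinpi scaleN1r opprK scale0r addr0 => /subr0_eq.
Qed.

End Invariant.
End Sphere.

Theorem corollary1p11 (R : realType) (f : 'rV[R]_3 -> R)
    (f_cont : {within S2, continuous f})
    (f_inv : forall u : 'rV[R]_3, S2 u ->
      exists T : 'End(subvs_of (perp u)),
        [/\ SO (perp u) T, T <> \1%VF, T <> - \1%VF
          & forall x : subvs_of (perp u), S2 (vsval x) ->
              f (vsval (T x)) = f (vsval x)]) :
  exists c : R, forall x : 'rV[R]_3, S2 x -> f x = c.
Proof.
have S2_nonempty : @S2 R !=set0.
  by have [w [ww _ _]] := exists_unit_normal 0 (0 : 'rV[R]_3); exists w; apply/S2E.
have [N NS fmax] := EVT_max_rV S2_nonempty (@compact_S2 R) f_cont.
have {}fmax y : S2 y -> f y <= f N by move=> yS; apply: fmax; rewrite inE.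
have NN : dot N N = 1 by apply/S2E; rewrite inE in NS.
exists (f N) => x /S2E xx.
(* [w] lies on the equator of the maximum point [N], so it is a maximum point too, and [x] lies on
   the equator of [w]. *)
have [w [ww wN wx]] := exists_unit_normal N x.
have fw : f w = f N by exact: max_on_equator.
by rewrite -fw; apply: max_on_equator => //; [rewrite dotC|rewrite fw].
Qed.
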